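(* Let $\pi$ be a recursive set of prime numbers. Then $\overline{\mathbf G}_{\pi}$-pointlikes are decidable: there is an algorithm which, given the multiplication table of a finite semigroup $T$, computes the set $\mathsf{PL}_{\overline{\mathbf G}_{\pi}}(T)$ of all $\overline{\mathbf G}_{\pi}$-pointlike subsets of $T$.
   Context: A $\pi$-group is a finite group whose order is divisible only by primes in $\pi$. $\overline{\mathbf G}_{\pi}$ is the pseudovariety of all finite semigroups all of whose subgroups (subsemigroups that are groups) are $\pi$-groups. A relational morphism $\varphi:T\to S$ of semigroups is a relation assigning to each $t\in T$ a non-empty subset $t\varphi\subseteq S$ with $(t\varphi)(t'\varphi)\subseteq (tt')\varphi$ for all $t,t'$; for $s\in S$, $s\varphi^{-1}=\{t\in T\mid s\in t\varphi\}$. For a pseudovariety $\mathbf V$, a subset $Z\subseteq T$ is $\mathbf V$-pointlike if for every relational morphism $\varphi:T\to S$ with $S\in\mathbf V$ there is $s\in S$ with $Z\subseteq s\varphi^{-1}$. $\mathsf{PL}_{\mathbf V}(T)$ is the set of $\mathbf V$-pointlike subsets of $T$. $\mathbf V$ has decidable pointlikes if $\mathsf{PL}_{\mathbf V}(T)$ is effectively computable from the multiplication table of the finite semigroup $T$. *)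

(* Defs.v *)
From HB Require Import structures.
From mathcomp Require Import all_boot.

Set Implicit Arguments.
Unset Strict Implicit.
Unset Printing Implicit Defensive.

(* The (total) recursive functions, in Kleene's presentation: the least class
   containing zero, successor and the projections and closed under
   composition, primitive recursion and minimization of regular functions.
   The functions built by the rules are given by pointwise equations, so the
   class is closed under extensional equality. *)
Inductive recursive : forall n, (n.-tuple nat -> nat) -> Prop :=
| RecZero (h : 0.-tuple nat -> nat) of (forall x, h x = 0) : recursive h
| RecSucc (h : 1.-tuple nat -> nat) of (forall x, h x = (thead x).+1) :
    recursive h
| RecProj n (i : 'I_n) (h : n.-tuple nat -> nat) of
    (forall x, h x = tnth x i) : recursive h
| RecComp m n (f : m.-tuple nat -> nat) (g : 'I_m -> n.-tuple nat -> nat)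
    (h : n.-tuple nat -> nat) of
    recursive f & (forall i, recursive (g i)) &
    (forall x, h x = f [tuple g i x | i < m]) : recursive h
| RecPrim n (f : n.-tuple nat -> nat) (g : n.+2.-tuple nat -> nat)
    (h : n.+1.-tuple nat -> nat) of
    recursive f & recursive g &
    (forall x : n.-tuple nat, h [tuple of 0 :: x] = f x) &
    (forall y (x : n.-tuple nat), h [tuple of y.+1 :: x] =
       g [tuple of y :: h [tuple of y :: x] :: x]) : recursive h
| RecMin n (f : n.+1.-tuple nat -> nat) (h : n.-tuple nat -> nat) of
    recursive f &
    (forall x, f [tuple of h x :: x] = 0) &
    (forall x y, y < h x -> f [tuple of y :: x] != 0) : recursive h.

Definition recursive_set (A : nat_pred) : Prop :=
  recursive (fun x : 1.-tuple nat => nat_of_bool (thead x \in A)).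

#[short(type="finSemigroupType")]
HB.structure Definition FinSemigroup := {G of Semigroup G & Finite G}.

Section Semigroups.

Local Open Scope group_scope.

Definition is_subgroup (S : finSemigroupType) (G : {set S}) : Prop :=
  (forall x y, x \in G -> y \in G -> x * y \in G) /\
  exists2 e, e \in G &
    forall x, x \in G ->
      [/\ e * x = x, x * e = x &
          exists2 y, y \in G & x * y = e /\ y * x = e].

Definition Gbar (pi : nat_pred) (S : finSemigroupType) : Prop :=
  forall G : {set S}, is_subgroup G -> pi.-nat #|G|.

Definition relational_morphism (T S : finSemigroupType) (phi : T -> {set S}) :
    Prop :=
  (forall t, phi t != set0) /\
  (forall t t' s s', s \in phi t -> s' \in phi t' -> s * s' \in phi (t * t')).

Definition pointlike (V : finSemigroupType -> Prop) (T : finSemigroupType)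
    (Z : {set T}) : Prop :=
  forall (S : finSemigroupType) (phi : T -> {set S}),
    V S -> relational_morphism phi ->
    exists s, Z \subset [set t | s \in phi t].

(* The elements of T are numbered 0, ..., #|T| - 1 by enum_rank; the table is
   listed row by row and turned into a number by the bijection CodeSeq.code
   from seq nat to nat. *)
Definition table_code (T : finSemigroupType) : nat :=
  CodeSeq.code
    (#|T| :: [seq nat_of_ord (enum_rank (x * y)) | x <- enum T, y <- enum T]).

End Semigroups.

(* Finite sets of numbers, and finite sets of such sets, are coded by the
   (injective) binary encoding A |-> \sum_(a in A) 2 ^ a. *)
Definition subset_code (T : finType) (Z : {set T}) : nat :=
  \sum_(x in Z) 2 ^ enum_rank x.

Definition family_code (T : finType) (P : {set {set T}}) : nat :=
  \sum_(Z in P) 2 ^ subset_code Z.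

Definition decidable_pointlikes (V : finSemigroupType -> Prop) : Prop :=
  exists2 f : 1.-tuple nat -> nat, recursive f &
    forall T : finSemigroupType,
      exists2 PL : {set {set T}},
        (forall Z, Z \in PL <-> pointlike V Z) &
        f [tuple table_code T] = family_code PL.

(* Main.v *)
From HB Require Import structures.
Require Import Defs.
From mathcomp Require Import all_boot all_fingroup all_solvable zify.

(** Call a family of subsets of T saturated if it contains the singletons, is
   closed under products and subsets, and contains the union of the W^(k+i),
   i < m, whenever it contains W, W^(k+m) = W^k and no prime of pi divides m.
   The pointlike subsets of T are the members of the least saturated family.
   If sets are coded by binary expansions, the code of that family is the least
   number coding a saturated family, so it is found by an unbounded search.

   Pointlikes are saturated because in a member of the pseudovariety some
   s^(k+n) = s^k with n a pi-number, hence coprime to m, so that by the Chinese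
   remainder theorem all W^(k+i) are related to one common power of s.

   For the converse, words over T act on the least saturated family by left
   multiplication, and we look for a finite semigroup X whose subgroups are
   pi-groups and a morphism from words to X such that words with the same image have an
   upper bound in the family. More generally letters act by monotone maps on a
   finite preordered set Y, and the induction is on #|Y|, then on the number of
   letters. If all letters permute Y they generate a group G, and one takes the
   quotient of G by the subgroup generated by its pi'-elements. Otherwise some
   letter c has c Y strictly smaller than Y: factor a word as
   u_0 c u_1 c ... c u_k with the u_i free of c, treat the u_i by induction on
   the alphabet, then the word (c u_1) ... (c u_(k-1)) over the alphabet of
   images of the u_i by induction on c Y, and glue the two semigroups by a
   Rees matrix construction. *)

Set Implicit Arguments.
Unset Strict Implicit.
Unset Printing Implicit Defensive.

(** * Semigroups whose subgroups are pi-groups *)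

Local Open Scope group_scope.

(** The equation says x^(p+1) = x. A test on single elements passes to [merge] more easily than a
    condition on subgroups. *)
Definition pi_aperiodic (pi : nat_pred) (X : finSemigroupType) : Prop :=
  forall (x : X) p,
    prime p -> p \notin pi -> iter p ( *%g x) x = x -> x * x = x.

(* A word u_0 c u_1 c ... c u_k with k > 0 is sent to the triple formed by the
   images of u_0, of (c u_1) ... (c u_(k-1)) and of u_k; [P] maps the image of
   u to that of the letter c u. *)
Definition merge (X Y : finSemigroupType) (P : X -> Y) : Type :=
  (X + X * Y * X)%type.

Section Merge.
Variables (X Y : finSemigroupType) (P : X -> Y).

HB.instance Definition _ := Finite.on (merge P).

(** The triples form a Rees matrix semigroup over [Y]: when two words are joined, the end [r] of one
    and the start [l'] of the other become one new block c r l'. *)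
Definition merge_mul (a b : merge P) : merge P :=
  match a, b with
  | inl s, inl s' => inl (s * s')
  | inl s, inr (l, x, r) => inr (s * l, x, r)
  | inr (l, x, r), inl s => inr (l, x, r * s)
  | inr (l, x, r), inr (l', x', r') => inr (l, x * P (r * l') * x', r')
  end.

Lemma merge_mulA : associative merge_mul.
Proof.
by move=> [s|[[l x] r]] [s'|[[l' x'] r']] [s''|[[l'' x''] r'']];
  rewrite /= ?mulgA.
Qed.

HB.instance Definition _ := isSemigroup.Build (merge P) merge_mulA.

Lemma merge_mulE (a b : merge P) : a * b = merge_mul a b.
Proof. by []. Qed.

Lemma iter_mul_inl (s : X) n :
  iter n ( *%g (inl s : merge P)) (inl s) = inl (iter n ( *%g s) s).
Proof. by elim: n => //= n ->. Qed.

Lemma iter_mul_inr (l r : X) (x : Y) n :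
  iter n ( *%g (inr (l, x, r) : merge P)) (inr (l, x, r)) =
    inr (l, iter n ( *%g (x * P (r * l))) x, r).
Proof. by elim: n => //= n ->. Qed.

(** For a triple the equation reads z^p x = x with z = x y and y = [P (r * l)]. Multiplying by y
    gives z^(p+1) = z, so z is idempotent and z x = z^p x = x. *)
Lemma pi_aperiodic_merge (pi : nat_pred) :
  pi_aperiodic pi X -> pi_aperiodic pi Y -> pi_aperiodic pi (merge P).
Proof.
move=> apX apY [s|[[l x] r]] p p_pr npi.
  by rewrite iter_mul_inl => -[/apX sE]; rewrite merge_mulE /= sE.
rewrite iter_mul_inr merge_mulE /= => -[]; set y := P _ => xE.
pose z := x * y.
have zE n : iter n ( *%g z) x * y = iter n ( *%g z) z.
  by elim: n => //= n <-; rewrite mulgA.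
have zz : z * z = z by apply: (apY _ p) => //; rewrite -zE xE.
suff: z * x = x by move->.
rewrite -{2}xE; case: p p_pr {npi xE} => // p _.
by elim: p => //= p <-; rewrite mulgA zz.
Qed.

End Merge.

HB.instance Definition _ (gT : finGroupType) (G : {group gT}) :=
  Finite.on (subg_of G).

Lemma pi_aperiodic_pgroup (pi : nat_pred) (gT : finGroupType) (G : {group gT}) :
  pi.-group G -> pi_aperiodic pi (subg_of G).
Proof.
move=> piG x p p_pr npi xE.
suff -> : x = 1 by rewrite mulg1.
apply: val_inj => /=; apply/eqP; rewrite -order_eq1.
have xp : sgval x ^+ p = 1.
  apply: (mulIg (sgval x)); rewrite mul1g -[RHS](congr1 sgval xE).
  by elim: (p) => [|n IHn]; rewrite ?mul1g //= expgS -mulgA IHn.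
have : #[sgval x] %| p by rewrite order_dvdn xp.
case/primeP: (p_pr) => _ /[apply] /orP[//|/eqP xo].
by move: (mem_p_elt piG (subgP x)); rewrite /p_elt xo pnatE // (negPf npi).
Qed.

Section PiResidual.
Variables (pi : nat_pred) (gT : finGroupType) (G : {group gT}).

Definition pi_residual : {set gT} := <<[set x in G | pi^'.-elt x]>>.
Canonical pi_residual_group := Eval hnf in [group of pi_residual].

Lemma pi_residual_normal : pi_residual <| G.
Proof.
rewrite /normal gen_subG norms_gen ?andbT.
  by apply/subsetP => x; rewrite inE => /andP[].
apply/subsetP => y Gy; rewrite inE; apply/subsetP => _ /imsetP[x + ->].
by rewrite !inE groupJr // p_eltJ.
Qed.

Lemma quotient_pi_residual : pi.-group (G / pi_residual).
Proof.
apply/pgroupP => p p_pr /(Cauchy p_pr)[_ /morphimP[x Nx Gx ->] /= xo].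
apply/negPn/negP => npi; have := prime_gt1 p_pr.
(* The pi'-constituent of the lift [x] has the same image as [x] but lies in the residual, so that
   image is trivial. *)
have /constt_p_elt : pi^'.-elt (coset pi_residual x) by rewrite /p_elt xo pnatE.
rewrite -morph_constt //= coset_id ?mem_gen //; last first.
  by rewrite inE groupX //= p_elt_constt.
by move=> x1; rewrite -xo -x1 order1.
Qed.

End PiResidual.

Section Words.
Variables (A : Type) (X : finSemigroupType) (e : X) (psi : A -> X).

(** The final [e] gives the empty word an image as well. *)
Definition word_prod (w : seq A) : X := foldr (fun a x => psi a * x) e w.

Lemma word_prod_cons a w : word_prod (a :: w) = psi a * word_prod w.
Proof. by []. Qed.

Lemma word_prod_cat v w :
  left_id e *%g -> word_prod (v ++ w) = word_prod v * word_prod w.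
Proof. by move=> e1; elim: v => //= a v ->; rewrite mulgA. Qed.

End Words.

(** * Bounding words by a finite quotient *)

Section Cover.
Variables (pi : nat_pred) (D : finType) (le : rel D).
Hypotheses (le_refl : reflexive le) (le_trans : transitive le).

(** Models left multiplication by the members of a saturated family; [sat_bound] replaces the union
    of the powers from k on. *)
Record saturated_monoid (Y : {set D}) (N : (D -> D) -> Prop) : Prop := {
  sat_stable : forall f, N f -> {in Y, forall y, f y \in Y};
  sat_homo : forall f, N f -> {in Y &, {homo f : y z / le y z}};
  sat_id : N id;
  sat_comp : forall f g, N f -> N g -> N (f \o g);
  sat_bound : forall f k m, N f -> pi^'.-nat m ->
    {in Y, forall y, iter (k + m) f y = iter k f y} ->
    exists2 h, N h & forall i, {in Y, forall y, le (iter (k + i) f y) (h y)}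
}.

(** [L x] bounds all words over [E] with image [x] simultaneously. *)
Definition covered (Y : {set D}) (N : (D -> D) -> Prop)
    (A : finType) (E : {set A}) (act : A -> D -> D) : Prop :=
  exists (X : finSemigroupType) (e : X) (psi : A -> X) (L : X -> D -> D),
    [/\ left_id e *%g, pi_aperiodic pi X, forall x, N (L x) &
        forall w, all (mem E) w ->
          {in Y, forall y, le (foldr act y w) (L (word_prod e psi w) y)}].

Lemma word_stable (Y : {set D}) (N : (D -> D) -> Prop)
    (A : finType) (E : {set A}) (act : A -> D -> D) w y :
  saturated_monoid Y N -> (forall a, a \in E -> N (act a)) ->
  all (mem E) w -> y \in Y -> foldr act y w \in Y.
Proof.
move=> satN NE + Yy; elim: w => //= a w IHw /andP[/NE Na /IHw].
exact: (sat_stable satN).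
Qed.

Lemma iter_stable (Y : {set D}) (N : (D -> D) -> Prop) f n y :
  saturated_monoid Y N -> N f -> y \in Y -> iter n f y \in Y.
Proof. by move=> satN Nf Yy; elim: n => //= n; apply: (sat_stable satN). Qed.

Lemma iter_period (f : D -> D) k m y i j :
  iter (k + m) f y = iter k f y -> iter (k + i + m * j) f y = iter (k + i) f y.
Proof.
move=> ky; have kj : iter (k + m * j) f y = iter k f y.
  elim: j => [|j IHj]; first by rewrite muln0 addn0.
  by rewrite mulnS addnA addnC iterD ky -iterD addnC.
by rewrite addnAC addnC iterD kj -iterD addnC.
Qed.

Lemma perm_extending (Y : {set D}) (f : D -> D) :
  f @: Y = Y -> exists g : {perm D}, {in Y, g =1 f}.
Proof.
move=> fY; have fI : {in Y &, injective f} by apply/imset_injP; rewrite fY.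
have YfY y : y \in Y -> f y \in Y by move=> Yy; rewrite -fY imset_f.
have gI : injective (fun y => if y \in Y then f y else y).
  move=> y z /=; case: ifPn => Yy; case: ifPn => Yz //.
  - exact: fI.
  - by move=> yz; rewrite -yz YfY in Yz.
  - by move=> yz; rewrite yz YfY in Yy.
by exists (perm gI) => y Yy; rewrite permE Yy.
Qed.

(* Here [g] is an anti-action: [foldr act y w] applies the last letter first,
   whence the inverses in the morphism [psi]. *)
Lemma covered_perm (Y : {set D}) (N : (D -> D) -> Prop)
    (A : finType) (E : {set A}) (act : A -> D -> D) :
  saturated_monoid Y N -> (forall a, a \in E -> N (act a)) ->
  (forall a, a \in E -> act a @: Y = Y) -> covered Y N E act.
Proof.
move=> satN NE actY.
have /fin_all_exists[g gE] a :
    exists g : {perm D}, a \in E -> {in Y, g =1 act a}.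
  have [/actY/perm_extending[g gE]|_] := boolP (a \in E).
    by exists g.
  by exists 1.
pose G := <<[set g a | a in E]>>%G; pose K := pi_residual_group pi G.
(* By finiteness, elements of [G] are products of generators without inverses. *)
have Nperm x : x \in G -> exists2 f, N f & {in Y, f =1 x}.
  move=> /gen_prodgP[n [c Ec ->]]; elim/big_rec: _ => [|i y _ [f Nf fE]].
    by exists id => [|y _]; [apply: sat_id satN | rewrite perm1].
  have /imsetP[a Ea ->] := Ec i.
  exists (f \o act a) => [|z Yz]; first exact: (sat_comp satN Nf (NE a Ea)).
  by rewrite permM gE //= fE // (sat_stable satN (NE a Ea)).
have GY x y : x \in G -> y \in Y -> x y \in Y.
  by move=> /Nperm[f Nf fE] Yy; rewrite -fE // (sat_stable satN Nf).
(* A pi'-element has pi'-order, so [sat_bound] with k = 0 bounds all its powers, the identity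
   included; these bounds compose along a product. *)
have NK x : x \in K ->
    exists2 h, N h & {in Y, forall y, le y (h y) && le (x y) (h y)}.
  move=> /gen_prodgP[n [c Kc ->]]; elim/big_rec: _ => [|i z _ [h Nh hE]].
    by exists id => [|y _]; [apply: sat_id satN | rewrite perm1 le_refl].
  have := Kc i; rewrite inE => /andP[Gc pi'c].
  have [f Nf fE] := Nperm _ Gc.
  have fX k y : y \in Y -> iter k f y = (c i ^+ k) y.
    move=> Yy; elim: k => [|k IHk]; first by rewrite perm1.
    by rewrite iterS IHk expgSr permM fE // GY ?groupX.
  have [|h' Nh' h'E] := @sat_bound _ _ satN f 0 _ Nf pi'c.
    by move=> y Yy; rewrite fX // expg_order perm1.
  exists (h \o h') => [|y Yy]; first exact: (sat_comp satN).
  have Yh'y := sat_stable satN Nh' Yy.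
  have /andP[hy _] := hE _ Yh'y.
  apply/andP; split; first exact: le_trans (h'E 0%N _ Yy) hy.
  rewrite permM -fE //.
  have Yfy := sat_stable satN Nf Yy.
  have /andP[_ /le_trans] := hE _ Yfy; apply.
  exact: (sat_homo satN Nh Yfy Yh'y (h'E 1%N _ Yy)).
(* Each bound from [NK] lies above the identity, so composing them over all of [K] loses none. *)
have [H NH HE] : exists2 h, N h &
    {in K, forall x : {perm D}, {in Y, forall y, le (x y) (h y)}}.
  suff [h Nh hE] : exists2 h, N h & {in Y, forall y, le y (h y) &&
      all (fun x : {perm D} => le (x y) (h y)) (enum K)}.
    exists h => // x Kx y /hE /andP[_ /allP]; apply.
    by rewrite mem_enum.
  have : all (mem K) (enum K) by apply/allP => x; rewrite mem_enum.
  elim: (enum K) => [_|x s IHs /= /andP[Kx /IHs[h Nh hE]]].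
    by exists id => [|y _]; [apply: sat_id satN | rewrite /= le_refl].
  have [h' Nh' h'E] := NK x Kx.
  exists (h' \o h) => [|y Yy]; first exact: (sat_comp satN).
  have Yhy := sat_stable satN Nh Yy.
  have /andP[h'hy _] := h'E _ Yhy.
  have /andP[hy hs] := hE _ Yy; have /andP[h'y h'x] := h'E _ Yy.
  rewrite /= (le_trans hy) //= (le_trans h'x) //=; last first.
    exact: (sat_homo satN Nh').
  by apply: sub_all hs => z /le_trans; apply.
have nKG : G \subset 'N(K) by apply: normal_norm (pi_residual_normal _ _).
(* For r = k s with k in [K], the permutation r^-1 applies s^-1 first and then k^-1, which [H]
   bounds. *)
have /fin_all_exists[L LE] (x : subg_of (G / K)) : exists l, N l /\
    (forall r, r \in G -> coset K r = sgval x ->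
     {in Y, forall y, le (r^-1 y) (l y)}).
  have /morphimP[s Ns Gs xs] := subgP x.
  have [f Nf fE] := Nperm _ (groupVr Gs).
  exists (H \o f); split => [|r Gr]; first exact: (sat_comp satN).
  have Nr := subsetP nKG _ Gr.
  rewrite xs => /(rcoset_kercosetP Nr Ns)/rcosetP[k Kk ->] y Yy.
  by rewrite invMg permM -fE // HE ?groupV // (sat_stable satN Nf).
pose psi a := subg (G / K) (coset K (g a)^-1).
pose e : subg_of (G / K) := 1.
exists (subg_of (G / K)), e, psi, L.
split=> [x|||w Ew y Yy]; first exact: mul1g.
- exact: pi_aperiodic_pgroup (quotient_pi_residual _ _).
- by move=> x; have [] := LE x.
pose r := foldr (fun a x => (g a)^-1 * x) 1 w.
have [Gr rE wE] : [/\ r \in G, coset K r = sgval (word_prod e psi w)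
                    & r^-1 y = foldr act y w].
  elim: w Ew @r => [_|a w IHw /= /andP[Ea Ew]].
    by rewrite /= morph1 invg1 perm1.
  have [Gr rE wE] := IHw Ew.
  have Ga : g a \in G by rewrite mem_gen // imset_f.
  rewrite groupM ?groupV // morphM ?(subsetP nKG) ?groupV //= rE.
  rewrite subgK ?mem_quotient ?groupV // invMg permM wE invgK gE //.
  exact: word_stable satN NE Ew Yy.
by rewrite -wE; have [_] := LE (word_prod e psi w); apply.
Qed.

(** Allows induction on the smaller set [c @: Y]: maps beginning a word with [c] send everything
    into it. *)
Lemma saturated_monoid_image (Y : {set D}) (N : (D -> D) -> Prop) c :
  saturated_monoid Y N -> N c ->
  saturated_monoid (c @: Y)
    (fun f => f = id \/ exists2 g, N g & f = c \o g).
Proof.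
move=> satN Nc; have cY : {subset c @: Y <= Y}.
  by move=> _ /imsetP[y Yy ->]; apply: (sat_stable satN Nc).
split.
- move=> _ [->|[g Ng ->]] y cYy //=.
  by apply: imset_f; apply: (sat_stable satN Ng); apply: cY.
- move=> _ [->|[g Ng ->]] y z /cY Yy /cY Yz //= yz.
  have Ncg := sat_comp satN Nc Ng.
  exact: (sat_homo satN Ncg).
- by left.
- move=> _ _ [->|[f Nf ->]] [->|[g Ng ->]]; [by left|..].
  + by right; exists g.
  + by right; exists f.
  right; exists (f \o (c \o g)) => //.
  by do 2!apply: (sat_comp satN) => //.
move=> _ k m [->|[f Nf ->]] pi'm kE.
  exists id; first by left.
  by move=> i y _; rewrite iter_fix.
have Ncf := sat_comp satN Nc Nf.
(* Periodicity is given only on [c @: Y]; one more application of [c \o f] moves all of [Y] there,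
   hence [k.+1]. *)
have [y Yy|h Nh hE] := @sat_bound _ _ satN _ k.+1 m Ncf pi'm.
  rewrite addSn !iterSr kE //=; apply: imset_f.
  exact: (sat_stable satN Nf).
exists ((c \o f) \o h).
  by right; exists (f \o h) => //; apply: (sat_comp satN).
have m_gt0 : (0 < m)%N by case/andP: pi'm.
(* The exponents are raised by [2 * m >= 2]: one unit to apply the bound at
   [k + 1], another to factor [c \o f] out of it. *)
move=> i y cYy; rewrite -(iter_period i 2 (kE _ cYy)).
have -> : (k + i + m * 2 = (k.+1 + (i + (m * 2 - 2))).+1)%N.
  by rewrite addSn -!addnS -addnA -subSn ?subSS -?addnBA; lia.
have Yy := cY y cYy; rewrite iterS; apply: (sat_homo satN Ncf).
- exact: (iter_stable _ satN Ncf Yy).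
- exact: (sat_stable satN Nh Yy).
exact: hE Yy.
Qed.

Theorem saturated_covered (Y : {set D}) (N : (D -> D) -> Prop)
    (A : finType) (E : {set A}) (act : A -> D -> D) :
  saturated_monoid Y N -> (forall a, a \in E -> N (act a)) ->
  covered Y N E act.
Proof.
have [n] := ubnP #|Y|; elim: n => // n IHn in Y N A E act *.
move=> Yn satN; have [m] := ubnP #|E|; elim: m => // m IHm in E *.
move=> Em NE; have [/forallP permE|] := boolP [forall a in E, act a @: Y == Y].
  by apply: covered_perm => // a /(implyP (permE a))/eqP.
rewrite negb_forall => /existsP[c]; rewrite negb_imply => /andP[Ec cYneq].
have Nc := NE c Ec; have cYY : act c @: Y \proper Y.
  rewrite properEneq cYneq; apply/subsetP => _ /imsetP[y Yy ->].
  exact: (sat_stable satN Nc).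
pose B := E :\ c.
have [||XB [e [psiB [LB [e1 apB NB LBE]]]]] := IHm B.
- by rewrite /B (cardsD1 c) Ec in Em.
- by move=> a /setD1P[_ /NE].
(* The letter [s] stands for all blocks c u with u of image [s], bounded together. *)
pose actC s := act c \o LB s.
have satC := saturated_monoid_image satN Nc.
have [||XC [eC [psiC [LC [eC1 apC NC LCE]]]]] :=
  IHn _ _ XB setT actC _ satC.
- exact: leq_trans (proper_card cYY) _.
- by move=> s _; right; exists (LB s).
have NLC x : N (LC x).
  have [->|[g Ng ->]] := NC x; first exact: (sat_id satN).
  exact: (sat_comp satN Nc Ng).
(* The last block c u_k is kept apart: it brings [y] into [act c @: Y], where [LC] is a valid
   bound. *)
pose L (z : merge psiC) := match z with
  | inl s => LB s
  | inr (l, x, r) => LB l \o (LC x \o (act c \o LB r))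
  end.
pose psi a : merge psiC := if a == c then inr (e, eC, e) else inl (psiB a).
exists (merge psiC), (inl e), psi, L; split=> [[s|[[l x] r]]|||].
- by rewrite merge_mulE /= e1.
- by rewrite merge_mulE /= e1.
- exact: pi_aperiodic_merge.
- by move=> [s|[[l x] r]] //=; do 3?apply: (sat_comp satN) => //.
move=> w Ew y Yy.
have cYsub : {subset act c @: Y <= Y} by apply/subsetP/proper_sub.
have NactC s : actC s = id \/ exists2 g, N g & actC s = act c \o g.
  by right; exists (LB s).
have allT (v : seq XB) : all (mem [set: XB]) v.
  by apply/allP => s _; rewrite /= inE.
have cLB r : act c (LB r y) \in act c @: Y.
  by rewrite imset_f // (sat_stable satN (NB r)).
have Yv v r : foldr actC (act c (LB r y)) v \in act c @: Y.
  exact: (word_stable satC (fun s _ => NactC s) (allT v) (cLB r)).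
have Yuv u v r : all (mem B) u ->
    foldr act (foldr actC (act c (LB r y)) v) u \in Y.
  move=> Bu; apply: word_stable satN NE _ (cYsub _ (Yv v r)).
  by apply: sub_all Bu => a /setD1P[].
have Yw v : all (mem E) v -> foldr act y v \in Y.
  by move=> Ev; apply: (word_stable satN NE).
(* Here u is u_0, and v lists the images of u_1, ..., u_(k-1). Prepending [c] turns u_0 into a new
   first letter of v and leaves u empty. *)
have wE : match word_prod (inl e : merge psiC) psi w return Prop with
  | inl s => all (mem B) w /\ s = word_prod e psiB w
  | inr (l, x, r) => exists u v, [/\ all (mem B) u, l = word_prod e psiB u,
      x = word_prod eC psiC v &
      le (foldr act y w)
         (foldr act (foldr actC (act c (LB r y)) v) u)]
  end.
  elim: w Ew => [|a w IHw] // /andP[Ea Ew].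
  have {IHw} := IHw Ew; rewrite [word_prod _ psi (a :: w)]word_prod_cons.
  rewrite [foldr _ _ (a :: w)]/= merge_mulE.
  rewrite {2}/psi; case: (word_prod _ psi w) =>
    [s [Bw ->]|[[l x] r] [u [v [Bu -> -> le_w]]]].
    case: eqP => [->|/eqP ac] /=; last first.
      by split; rewrite // Bw andbT; apply/setD1P.
    exists [::], [::]; split=> //=; rewrite e1.
    apply: (sat_homo satN Nc); [exact: Yw| |exact: LBE].
    exact: (sat_stable satN (NB _)).
  have le_aw := sat_homo satN (NE a Ea) (Yw _ Ew) (Yuv u v r Bu) le_w.
  case: eqP => [ac|/eqP ac] /=; last first.
    by exists (a :: u), v; split; rewrite //= Bu andbT; apply/setD1P.
  exists [::], (word_prod e psiB u :: v); rewrite /= e1 eC1; split=> //.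
  apply: le_trans le_aw _; rewrite ac.
  have Yv' := cYsub _ (Yv v r).
  apply: (sat_homo satN Nc); [exact: Yuv| |exact: LBE].
  exact: (sat_stable satN (NB _)).
case: (word_prod _ psi w) wE =>
  [s [Bw ->]|[[l x] r] [u [v [Bu -> -> le_w]]]] /=.
  exact: LBE.
apply: le_trans le_w _; have cYv := Yv v r.
apply: le_trans (LBE u Bu _ (cYsub _ cYv)) _.
have le_v := LCE v (allT v) _ (cLB r).
apply: (sat_homo satN (NB _)) le_v; first exact: cYsub.
by apply: (sat_stable satN (NLC _)); apply: cYsub.
Qed.

End Cover.

(** * Pointlike sets are the least saturated family *)

(** Left multiplication on [G], extended by the identity outside, realizes [G] up to reversal as a
    permutation group; Cauchy's theorem there yields an x of order p with x^(p+1) = x. *)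
Lemma pi_aperiodic_Gbar (pi : nat_pred) (S : finSemigroupType) :
  pi_aperiodic pi S -> Gbar pi S.
Proof.
move=> apS G [GM [e Ge eG]].
apply/andP; split; first by apply/card_gt0P; exists e.
apply/allP => p; rewrite mem_primes => /and3P[p_pr _ p_dv].
apply/negPn/negP => npi.
have eL x : x \in G -> e * x = x by case/eG.
pose f x y := if (x \in G) && (y \in G) then x * y else y.
have fI x : injective (f x).
  move=> y z; rewrite /f; have [Gx|] //= := boolP (x \in G).
  have [_ _ [x' Gx' [_ x'x]]] := eG x Gx.
  case: ifP => Gy; case: ifP => Gz //.
  - by move/(congr1 ( *%g x')); rewrite !mulgA x'x !eL.
  - by move=> yz; rewrite -yz GM in Gz.
  - by move=> yz; rewrite yz GM in Gy.
pose g x := perm (@fI x).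
have gE x y : x \in G -> y \in G -> g x y = x * y.
  by move=> Gx Gy; rewrite permE /f Gx Gy.
have g1 : g e = 1.
  by apply/permP => y; rewrite permE perm1 /f Ge; case: ifP => //= /eL.
have gM x y : x \in G -> y \in G -> g x * g y = g (y * x).
  move=> Gx Gy; apply/permP => z; rewrite permM !permE /f Gx Gy GM //=.
  by case: (boolP (z \in G)) => Gz; rewrite ?GM ?(negPf Gz) // mulgA.
have gset : group_set [set g x | x in G].
  apply/group_setP; split; first by rewrite -g1 imset_f.
  move=> _ _ /imsetP[x Gx ->] /imsetP[y Gy ->].
  by rewrite gM // imset_f // GM.
pose H := Group gset.
have cardH : #|H| = #|G|.
  rewrite card_in_imset // => x y Gx Gy xy.
  have [_ <- _] := eG x Gx; have [_ <- _] := eG y Gy.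
  by rewrite -!gE // xy.
have [|_ /imsetP[x Gx ->] xo] := @Cauchy _ p H p_pr; first by rewrite cardH.
have xX n : (g x ^+ n) x = iter n ( *%g x) x /\ iter n ( *%g x) x \in G.
  elim: n => [|n [IHn Gn]]; first by rewrite perm1.
  by rewrite expgSr permM IHn /= gE // GM.
have := apS x p p_pr npi; rewrite -(xX p).1 -{1}xo expg_order perm1.
move=> /(_ erefl) xx.
have xe : x = e.
  have [_ xe [y Gy [xy _]]] := eG x Gx.
  by rewrite -[LHS]xe -[in LHS]xy mulgA xx xy.
by have := prime_gt1 p_pr; rewrite -xo xe g1 order1.
Qed.

(** * Periods of powers in finite semigroups *)

Lemma iter_mulgD (S : semigroupType) (s : S) i j :
  iter i ( *%g s) s * iter j ( *%g s) s = iter (i + j).+1 ( *%g s) s.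
Proof. by elim: i => //= i IHi; rewrite -mulgA IHi. Qed.

Lemma iter_collision (V : finType) (f : V -> V) x :
  exists i, exists2 e, (0 < e)%N && (i + e <= #|V|)%N &
    iter (i + e) f x = iter i f x.
Proof.
have /injectivePn[i [j ij eqij]] :
    ~~ injectiveb (fun i : 'I_#|V|.+1 => iter i f x).
  by apply/injectiveP => /leq_card; rewrite card_ord ltnn.
wlog ltij : i j ij eqij / (i < j)%N.
  move=> IH; have [|ji|/val_inj] := ltngtP i j;
    [exact: IH| |by move/eqP; rewrite (negPf ij)].
  by apply: (IH j i) ji; rewrite // eq_sym.
exists i, (j - i)%N; rewrite subnKC ?(ltnW ltij) //.
by rewrite subn_gt0 ltij -ltnS ltn_ord.
Qed.

(** The recurrent powers of [s] form a group whose order is the period. *)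
Lemma Gbar_index_period (pi : nat_pred) (S : finSemigroupType) (s : S) :
  Gbar pi S -> exists k n, pi.-nat n /\
    iter (k + n) ( *%g s) s = iter k ( *%g s) s.
Proof.
move=> piS; pose pw n := iter n ( *%g s) s.
have [k [m /andP[m_gt0 _] pwm]] := iter_collision ( *%g s) s.
have pwX i j : pw (k + i + m * j)%N = pw (k + i)%N by apply: iter_period.
have pwD i j : pw i * pw j = pw (i + j).+1 by apply: iter_mulgD.
have kC : iter m ( *%g s) (pw k) = pw k by rewrite -iterD addnC.
pose n := fingraph.order ( *%g s) (pw k).
have nC : iter n ( *%g s) (pw k) = pw k.
  by apply/(@orbitPcycle _ _ _ 3 4); exists m.-1; rewrite prednK.
exists k, n; split; last by rewrite addnC iterD.
pose G := [set x in fconnect ( *%g s) (pw k)].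
have -> : n = #|G| by rewrite cardsE.
have GP x : reflect (exists i, x = pw (k + i)%N) (x \in G).
  rewrite inE; apply: (iffP idP) => [/iter_findex <-|[i ->]].
    by exists (findex ( *%g s) (pw k) x); rewrite addnC /pw iterD.
  by rewrite /pw [(k + i)%N]addnC iterD; apply: fconnect_iter.
apply: piS; split.
  move=> _ _ /GP[i ->] /GP[j ->]; apply/GP; exists (i + k + j).+1.
  by rewrite pwD; congr pw; lia.
(* As [pw j] is s^(j+1), the identity is s^(m(k+1)): a multiple of the period as exponent, beyond
   k. *)
have eE : (k + (m * k.+1 - k.+1)).+1 = (m * k.+1)%N by nia.
exists (pw (k + (m * k.+1 - k.+1))%N); first by apply/GP; eexists.
move=> _ /GP[i ->]; split.
- by rewrite pwD -addSn eE addnC pwX.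
- by rewrite pwD -addnS eE pwX.
(* Chosen so that the exponents of the element and its inverse add up to m(k+1) + m(k+i+1). *)
pose t := (k + (m * k.+1 - k.+1 + m * (k + i).+1 - (k + i).+1))%N.
exists (pw t); first by apply/GP; eexists.
suff tE : pw (k + i + t).+1 = pw (k + (m * k.+1 - k.+1))%N.
  by rewrite !pwD tE [(t + _)%N]addnC tE.
by rewrite -(pwX _ (k + i).+1) /t; congr pw; nia.
Qed.

(** The pigeonhole principle gives some period e of at most [#|V|]; by Bezout the gcd of e and m is
    a period too. *)
Lemma iter_short_period (V : finType) (f : V -> V) x k m : (0 < m)%N ->
  iter (k + m) f x = iter k f x ->
  exists2 d, (d <= #|V|)%N && (d %| m) &
    iter (#|V| + d) f x = iter #|V| f x.
Proof.
move=> m_gt0 km; set n := #|V|.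
have [i [e /andP[e_gt0 len] ie]] := iter_collision f x.
have ne a c : iter (n + a + e * c) f x = iter (n + a) f x.
  have -> : (n + a = i + (n - i + a))%N by lia.
  exact: iter_period.
(* Since k may exceed n, the index is first raised by e * k. *)
have nm a c : iter (n + a + m * c) f x = iter (n + a) f x.
  rewrite -(ne a k) -addnA -(ne (a + m * c)%N k).
  have -> : (n + (a + m * c) + e * k = k + (n + a + e * k - k) + m * c)%N.
    by nia.
  have {2}-> : (n + a + e * k = k + (n + a + e * k - k))%N by nia.
  exact: iter_period.
exists (gcdn e m).
  rewrite dvdn_gcdr andbT (leq_trans (dvdn_leq e_gt0 (dvdn_gcdl e m))) //.
  by lia.
case: (egcdnP m e_gt0) => u v uv _.
rewrite -(nm _ v) -[in RHS](addn0 n) -(ne 0%N u); congr (iter _ f x); nia.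
Qed.

(** * Saturated families and soundness *)

Section SaturatedFamilies.
Variables (pi : nat_pred) (T : finSemigroupType).
Implicit Types (A B : {set T}) (P : {set {set T}}).

Definition setmul A B : {set T} := [set a * b | a in A, b in B].

(** The exponent is shifted: this is A^(n+1). *)
Definition setpow A n : {set T} := iter n (setmul A) A.

(* [2 ^ #|T|] is the number of subsets of T: the powers of [A] are periodic
   from there on, and short periods suffice (see [saturated_bound]). *)
Definition saturated P : bool :=
  [&& [forall t, [set t] \in P],
      [forall A in P, forall B in P, setmul A B \in P],
      [forall A in P, forall B : {set T}, (B \subset A) ==> (B \in P)] &
      [forall A in P, forall m : 'I_(2 ^ #|T|).+1,
        pi^'.-nat m ==> (setpow A (2 ^ #|T| + m) == setpow A (2 ^ #|T|)) ==>
        (\bigcup_(i < m) setpow A (2 ^ #|T| + i) \in P)]].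

Definition saturation : {set {set T}} := \bigcap_(P | saturated P) P.

Lemma setmulP A B x :
  reflect (exists a b, [/\ a \in A, b \in B & x = a * b]) (x \in setmul A B).
Proof.
apply: (iffP imset2P) => [[a b Aa Bb ->]|[a [b [Aa Bb ->]]]].
  by exists a, b.
by exists a b.
Qed.

Lemma setmulA : associative setmul.
Proof.
move=> A B C; apply/setP => x; apply/setmulP/setmulP.
  move=> [a [_ [Aa /setmulP[b [c [Bb Cc ->]]] ->]]].
  by exists (a * b), c; split; rewrite ?mulgA //; apply/setmulP; exists a, b.
move=> [_ [c [/setmulP[a [b [Aa Bb ->]]] Cc ->]]].
by exists a, (b * c); split; rewrite ?mulgA //; apply/setmulP; exists b, c.
Qed.

Lemma setmulSS A A' B B' :
  A \subset A' -> B \subset B' -> setmul A B \subset setmul A' B'.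
Proof.
move=> /subsetP sA /subsetP sB; apply/subsetP => _ /setmulP[a [b [Aa Bb ->]]].
by apply/setmulP; exists a, b; rewrite sA ?sB.
Qed.

Lemma saturatedP P :
  reflect [/\ forall t, [set t] \in P,
              {in P &, forall A B, setmul A B \in P},
              {in P, forall A B, B \subset A -> B \in P} &
              {in P, forall A m, (m <= 2 ^ #|T|)%N -> pi^'.-nat m ->
                setpow A (2 ^ #|T| + m) = setpow A (2 ^ #|T|) ->
                \bigcup_(i < m) setpow A (2 ^ #|T| + i) \in P}]
    (saturated P).
Proof.
apply: (iffP and4P) => -[P1 P2 P3 P4]; split.
- exact/forallP.
- move=> A B PA; apply/implyP; have := forallP P2 A; rewrite PA => /forallP.
  exact.
- move=> A PA B; apply/implyP; have := forallP P3 A; rewrite PA => /forallP.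
  exact.
- move=> A PA m; rewrite -ltnS => lem pi'm Am.
  have := forallP P4 A; rewrite PA => /forallP/(_ (Ordinal lem)).
  by rewrite pi'm Am eqxx.
- exact/forallP.
- by apply/forall_inP => A PA; apply/forall_inP => B; apply: P2.
- by apply/forall_inP => A PA; apply/forall_inP => B; apply: P3.
- apply/forall_inP => A PA; apply/forallP => m.
  by apply/implyP => pi'm; apply/implyP => /eqP; apply: P4 => //; rewrite -ltnS.
Qed.

Lemma saturationS P : saturated P -> saturation \subset P.
Proof. by move=> satP; apply: bigcap_inf. Qed.

Lemma saturation_saturated : saturated saturation.
Proof.
apply/saturatedP; split=> [t|A B /bigcapP SA /bigcapP SB|A /bigcapP SA B AB|].
- by apply/bigcapP => P /saturatedP[].
- by apply/bigcapP => P satP; case/saturatedP: (satP) => _ + _ _; apply; auto.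
- by apply/bigcapP => P satP; case/saturatedP: (satP) => _ _ + _; apply; eauto.
move=> A /bigcapP SA m lem pi'm Am; apply/bigcapP => P satP.
by case/saturatedP: (satP) => _ _ _; apply; auto.
Qed.

(** Lifts the bounds on index and period in [saturated]: the short period d divides m, so it is
    still a pi'-number. *)
Lemma saturated_bound P A k m : saturated P -> A \in P -> pi^'.-nat m ->
  setpow A (k + m) = setpow A k ->
  exists2 B, B \in P & forall i, setpow A (k + i) \subset B.
Proof.
case/saturatedP => _ _ _ satP PA pi'm km.
have m_gt0 : (0 < m)%N by case/andP: pi'm.
have := iter_short_period m_gt0 km.
have -> : #|{: {set T}}| = (2 ^ #|T|)%N.
  by rewrite -cardsT -[in RHS]cardsT -card_powerset powersetT.
set n := (2 ^ _)%N => -[d /andP[ledn dm] nd].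
have pi'd : pi^'.-nat d by apply: pnat_dvd pi'm.
have d_gt0 : (0 < d)%N by case/andP: pi'd.
exists (\bigcup_(i < d) setpow A (n + i)); first exact: satP.
move=> i; rewrite /setpow -(iter_period i n km).
(* Adding n periods m carries the index past n, after which it is reduced modulo d. *)
have -> : (k + i + m * n = n + (k + i + m * n - n))%N by nia.
set j := (_ - n)%N.
have -> : (n + j = n + j %% d + d * (j %/ d))%N.
  by rewrite -addnA addnC [in LHS](divn_eq j d); lia.
rewrite iter_period //.
exact: (bigcup_sup (Ordinal (ltn_pmod j d_gt0))).
Qed.

Lemma preimage_family_saturated (S : finSemigroupType) (phi : T -> {set S}) :
  Gbar pi S -> relational_morphism phi ->
  saturated [set Z : {set T} | [exists s, Z \subset [set t | s \in phi t]]].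
Proof.
move=> piS [phi0 phiM]; have preM A B s s' : A \subset [set t | s \in phi t] ->
    B \subset [set t | s' \in phi t] ->
    setmul A B \subset [set t | s * s' \in phi t].
  move=> /subsetP sA /subsetP sB; apply/subsetP => _ /setmulP[a [b [Aa Bb ->]]].
  by have := sA a Aa; have := sB b Bb; rewrite !inE => *; apply: phiM.
apply/saturatedP; split=> [t|A B|A|A].
- rewrite inE; have /set0Pn[s ts] := phi0 t.
  by apply/existsP; exists s; rewrite sub1set inE.
- rewrite !inE => /existsP[s sA] /existsP[s' sB].
  by apply/existsP; exists (s * s'); apply: preM.
- rewrite !inE => /existsP[s sA] B sBA; rewrite inE.
  by apply/existsP; exists s; apply: subset_trans sA.
rewrite inE => /existsP[s sA] m _ pi'm; set N := (2 ^ _)%N => Am.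
have sX i : setpow A i \subset [set t | iter i ( *%g s) s \in phi t].
  by elim: i => //= i; apply: preM.
have [k [n [pin kn]]] := Gbar_index_period s piS.
have co_mn : coprime m n by rewrite coprime_sym; apply: pnat_coprime pi'm.
rewrite inE; apply/existsP; exists (iter k ( *%g s) s).
apply/bigcupsP => i _; pose c := chinese m n (N + i) k.
have m_gt0 : (0 < m)%N by case/andP: pi'm.
have n_gt0 : (0 < n)%N by case/andP: pin.
(* Congruent to N + i modulo m and to k modulo n, and large enough for both periodicities to
   apply. *)
pose x := (c + m * n * (N + i + k))%N.
have [a xa] : exists a, x = (N + i + m * a)%N.
  have lex : (N + i <= x)%N.
    apply: leq_trans (leq_addl _ _); apply: leq_trans (leq_addr k (N + i)%N) _.
    by rewrite leq_pmull // muln_gt0 m_gt0.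
  have /dvdnP[a xa] : (m %| x - (N + i))%N.
    by rewrite -eqn_mod_dvd // /x -mulnA addnC mulnC modnMDl chinese_modl.
  by exists a; rewrite mulnC -xa subnKC.
have [b xb] : exists b, x = (k + n * b)%N.
  have lex : (k <= x)%N.
    apply: leq_trans (leq_addl _ _); apply: leq_trans (leq_addl (N + i)%N k) _.
    by rewrite leq_pmull // muln_gt0 m_gt0.
  have /dvdnP[b xb] : (n %| x - k)%N.
    rewrite -eqn_mod_dvd // /x mulnAC [(m * _ * n)%N]mulnC addnC mulnC.
    by rewrite modnMDl chinese_modr.
  by exists b; rewrite mulnC -xb subnKC.
have -> : setpow A (N + i) = setpow A x by rewrite xa /setpow iter_period.
have -> : iter k ( *%g s) s = iter x ( *%g s) s.
  by rewrite xb -[k in (k + _)%N]addn0 iter_period ?addn0.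
exact: sX.
Qed.

End SaturatedFamilies.

(** * Every pointlike set lies in the least saturated family *)

Section Completeness.
Variables (pi : nat_pred) (T : finSemigroupType).
Let D := option {set T}.
Let CP := saturation pi T.

(* [None] plays the part of an identity element adjoined to the semigroup of
   subsets, so that the empty word acts. *)
Definition opt_subset (x y : D) : bool :=
  match x, y with
  | Some A, Some B => A \subset B
  | None, None => true
  | _, _ => false
  end.

Definition opt_setmul (W : {set T}) (x : D) : D :=
  Some (if x is Some A then setmul W A else W).

Definition opt_saturation : {set D} :=
  [set x | if x is Some A then A \in CP else true].

(** Pointwise equality makes the class closed under composition without function extensionality. *)
Definition opt_translation (f : D -> D) : Prop :=
  f =1 id \/ exists2 W, W \in CP & f =1 opt_setmul W.

Lemma opt_subset_refl : reflexive opt_subset.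
Proof. by case=> /=. Qed.

Lemma opt_subset_trans : transitive opt_subset.
Proof. by move=> [A|] [B|] [C|] //=; apply: subset_trans. Qed.

Lemma iter_opt_setmul W x n :
  iter n.+1 (opt_setmul W) x = opt_setmul (setpow W n) x.
Proof.
elim: n => [|n IHn] //; rewrite iterS IHn; case: x {IHn} => //= A.
by rewrite /opt_setmul setmulA.
Qed.

Lemma opt_translation_saturated :
  saturated_monoid pi opt_subset opt_saturation opt_translation.
Proof.
have /saturatedP[_ CPM _ _] := saturation_saturated pi T.
split.
- move=> f [fE x|[W PW fE] x]; rewrite fE // !inE.
  by case: x => //= A PA; apply: CPM.
- move=> f [fE x y _ _|[W PW fE] x y _ _]; rewrite !fE //.
  by case: x y => [A|] [B|] //=; apply: setmulSS.
- by left.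
- move=> f g [fE|[W PW fE]] [gE|[V PV gE]].
  + by left=> x /=; rewrite fE gE.
  + by right; exists V => // x /=; rewrite fE gE.
  + by right; exists W => // x /=; rewrite fE gE.
  right; exists (setmul W V); first exact: CPM.
  by move=> [A|] /=; rewrite fE gE //= /opt_setmul setmulA.
move=> f k m [fE|[W PW fE]] pi'm km.
  exists id => [|i y _]; first by left.
  by rewrite (eq_iter fE) iter_fix // opt_subset_refl.
have fX n x : iter n f x = iter n (opt_setmul W) x by apply: eq_iter.
have [|B PB BE] := saturated_bound (saturation_saturated pi T) PW pi'm (k := k).
  have := km (Some W); rewrite inE PW => /(_ erefl); rewrite !fX.
  have powE n : iter n (opt_setmul W) (Some W) = Some (setpow W n).
    by elim: n => //= n ->.
  by rewrite !powE => -[].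
exists (opt_setmul B) => [|i y Yy]; first by right; exists B.
(* One extra period makes the number of iterations positive, so that it is multiplication by a power
   of [W] even if k + i = 0. *)
rewrite -(iter_period i 1 (km y Yy)) fX.
have m_gt0 : (0 < m)%N by case/andP: pi'm.
have -> : (k + i + m * 1 = (k + (i + m - 1)).+1)%N by lia.
by rewrite iter_opt_setmul; case: y {Yy} => [A|] /=; rewrite ?setmulSS.
Qed.

(** Reachability in this finite graph decides whether some word has a given value in [T] and a given
    image in [X], so the relation can be a [{set X}]. *)
Definition word_step (X : finSemigroupType) (psi : T -> X)
    (u v : option T * X) : bool :=
  [exists a, (v.1 == Some (if u.1 is Some t then a * t else a)) &&
             (v.2 == psi a * u.2)].

Definition word_eval (w : seq T) : option T :=
  foldr (fun a o => Some (if o is Some t then a * t else a)) None w.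

Lemma connect_word (X : finSemigroupType) (e : X) (psi : T -> X) o x :
  reflect (exists2 w, word_eval w = o & word_prod e psi w = x)
          (connect (word_step psi) (None, e) (o, x)).
Proof.
apply: (iffP connectP) => [[p]|[w <- <-]].
  elim/last_ind: p o x => [|p [o' x'] IHp] o x.
    by move=> _ [-> ->]; exists [::].
  rewrite rcons_path last_rcons.
  move=> /andP[pp /existsP[a /andP[/= ao ax]]] [-> ->].
  case lpE: (last _ p) ao ax => [o1 x1] /= /eqP -> /eqP ->.
  by have [w <- <-] := IHp o1 x1 pp (esym lpE); exists (a :: w).
elim: w => [|a w [p pp lp]]; first by exists [::].
exists (rcons p (word_eval (a :: w), word_prod e psi (a :: w))).
  by rewrite rcons_path pp -lp /=; apply/existsP; exists a; rewrite /= !eqxx.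
by rewrite last_rcons.
Qed.

Lemma word_eval_cat v w t u : word_eval v = Some t -> word_eval w = Some u ->
  word_eval (v ++ w) = Some (t * u).
Proof.
move=> + wu; elim: v t => // a [|b v] IHv t [<-]; first by rewrite /= wu.
by have /= [->] := IHv _ erefl; rewrite mulgA.
Qed.

(** Relate t to the images of all words with value t. A pointlike [Z] is related to a single s, and
    [L s None] then contains every element of [Z]. *)
Lemma pointlike_in_saturation (Z : {set T}) :
  pointlike (Gbar pi) Z -> Z \in CP.
Proof.
have /saturatedP[CP1 _ CPS _] := saturation_saturated pi T.
have NE t : t \in setT -> opt_translation (opt_setmul [set t]).
  by right; exists [set t]; first exact: CP1.
have [X [e [psi [L [e1 apX NL LE]]]]] :=
  saturated_covered opt_subset_refl opt_subset_trans
    opt_translation_saturated NE.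
pose phi t := [set x | connect (word_step psi) (None, e) (Some t, x)].
have phiM : relational_morphism phi.
  split=> [t|t u x y].
    apply/set0Pn; exists (word_prod e psi [:: t]); rewrite inE.
    by apply/connect_word; exists [:: t].
  rewrite !inE => /connect_word[v vt <-] /connect_word[w wu <-].
  apply/connect_word; exists (v ++ w); first exact: word_eval_cat.
  exact: word_prod_cat.
move=> plZ; have [s Zs] := plZ _ _ (pi_aperiodic_Gbar apX) phiM.
have sL t : t \in Z -> opt_subset (Some [set t]) (L s None).
  move=> /(subsetP Zs); rewrite !inE => /connect_word[w wt <-].
  have allT : all (mem [set: T]) w by apply/allP => a _; rewrite /= inE.
  have := LE w allT None; rewrite inE => /(_ erefl).
  have -> // : foldr (fun t => opt_setmul [set t]) None w =
      omap set1 (word_eval w).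
    elim: w {wt allT} => //= a w ->; case: (word_eval w) => //= u.
    congr Some; apply/setP => x; rewrite inE.
    apply/setmulP/eqP => [[_ [_ [/set1P -> /set1P -> ->]]] //|->].
    by exists a, u; rewrite !inE.
  by rewrite wt.
have [LsE|[W PW LsE]] := NL s; last first.
  apply: (CPS _ PW); apply/subsetP => t /sL.
  by rewrite LsE /= sub1set.
(* If [L s] is the identity, its value at [None] is above no subset. *)
have Z0 : Z = set0.
  by apply/setP => t; rewrite inE; apply/negP => /sL; rewrite LsE.
have [t _|T0] := pickP T; first by apply: (CPS _ (CP1 t)); rewrite Z0 sub0set.
(* Over the empty semigroup even the empty set is not pointlike: [T] itself offers no point. *)
have [||t] := plZ T (fun t => [set t]); last by have := T0 t.
  by move=> G [_ [t]]; have := T0 t.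
by split=> [t|t]; have := T0 t.
Qed.

Lemma saturation_pointlike (Z : {set T}) :
  Z \in CP <-> pointlike (Gbar pi) Z.
Proof.
split; last exact: pointlike_in_saturation.
move=> PZ S phi piS phiM.
have := subsetP (saturationS (preimage_family_saturated piS phiM)) _ PZ.
by rewrite inE => /existsP.
Qed.

End Completeness.

Local Close Scope group_scope.

(** * Recursive functions *)

(** Lists avoid casts between tuple lengths; only the values on lists of length n matter. *)
Definition rec n (F : seq nat -> nat) : Prop :=
  recursive (fun x : n.-tuple nat => F x).

Definition ball m (b : nat -> bool) : bool := [forall i : 'I_m, b i].
Definition bsum m (F : nat -> nat) : nat := \sum_(i < m) F i.

Lemma ballP m (b : nat -> bool) : reflect (forall i, i < m -> b i) (ball m b).
Proof.
apply: (iffP forallP) => [H i im|H i]; last exact: H.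
exact: (H (Ordinal im)).
Qed.

Lemma rec_ext n F G : (forall s, size s = n -> F s = G s) -> rec n F -> rec n G.
Proof.
move=> FG recF; apply: (RecComp recF (g := fun i x => tnth x i)) => [i|x].
  exact: RecProj.
rewrite -FG ?size_tuple //; congr F; rewrite /= -[LHS]map_tnth_enum.
by [].
Qed.

Lemma rec_comp m n F (G : nat -> seq nat -> nat) :
  rec m F -> (forall i, i < m -> rec n (G i)) ->
  rec n (fun s => F (mkseq (G^~ s) m)).
Proof.
move=> recF recG; apply: (RecComp recF (g := fun i x => G i x)) => [i|x].
  exact: recG.
by congr F; rewrite /mkseq -val_enum_ord -map_comp; apply: eq_map.
Qed.

Lemma rec_const n c : rec n (fun=> c).
Proof.
have rec0 : rec 0 (fun=> 0) by apply: RecZero.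
elim: c => [|c IHc]; first by apply: (rec_comp (G := fun _ _ => 0) rec0).
have recS : rec 1 (fun s => (head 0 s).+1).
  by apply: RecSucc => x; rewrite (tuple_eta x).
by apply: (rec_comp (G := fun _ _ => c) recS).
Qed.

Lemma rec_var n k : rec n (fun s => nth 0 s k).
Proof.
have [kn|nk] := ltnP k n.
  by apply: (@RecProj _ (Ordinal kn)) => x; rewrite (tnth_nth 0).
by apply: rec_ext (rec_const n 0) => s sn; rewrite nth_default ?sn.
Qed.

(** Bounded operators push their variable in front, so an outer variable is seen through one
    [behead] per level. *)
Lemma rec_var_behead n j k : rec n (fun s => nth 0 (iter j behead s) k).
Proof.
apply: rec_ext (rec_var n (j + k)) => s _; elim: j k => //= j IHj k.
by rewrite nth_behead -IHj addSnnS.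
Qed.

Lemma rec_app1 n f F : rec 1 (fun s => f (nth 0 s 0)) -> rec n F ->
  rec n (fun s => f (F s)).
Proof. by move=> rf rF; apply: (rec_comp (G := fun _ => F) rf). Qed.

Lemma rec_app2 n f F1 F2 : rec 2 (fun s => f (nth 0 s 0) (nth 0 s 1)) ->
  rec n F1 -> rec n F2 -> rec n (fun s => f (F1 s) (F2 s)).
Proof.
by move=> rf r1 r2; apply: (rec_comp (G := nth F1 [:: F1; F2]) rf) => -[|[|]].
Qed.

Lemma rec_app3 n f F1 F2 F3 :
  rec 3 (fun s => f (nth 0 s 0) (nth 0 s 1) (nth 0 s 2)) ->
  rec n F1 -> rec n F2 -> rec n F3 -> rec n (fun s => f (F1 s) (F2 s) (F3 s)).
Proof.
move=> rf r1 r2 r3.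
by apply: (rec_comp (G := nth F1 [:: F1; F2; F3]) rf) => -[|[|[|]]].
Qed.

Lemma mkseq_cons n F (s : seq nat) : size s = n ->
  mkseq (fun i => if i is j.+1 then nth 0 s j else F) n.+1 = F :: s.
Proof.
move=> sn; rewrite /mkseq /=; congr cons.
rewrite (iotaDl 1 0) -map_comp -[RHS](mkseq_nth 0) sn.
exact: eq_map.
Qed.

Lemma rec_subst n F G : rec n.+1 F -> rec n G -> rec n (fun s => F (G s :: s)).
Proof.
move=> rF rG.
pose H i s := if i is j.+1 then nth 0 s j else G s.
apply: rec_ext (rec_comp (G := H) rF _) => [s sn|[|i] _ //].
  by rewrite -(mkseq_cons _ sn); congr F; apply: eq_map => -[].
exact: rec_var.
Qed.

Lemma rec_iteri n F G T : rec n F ->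
  rec n.+2 (fun s => G (behead (behead s)) (nth 0 s 0) (nth 0 s 1)) ->
  rec n T ->
  rec n (fun s => iteri (T s) (G s) (F s)).
Proof.
move=> rF rG; apply: (rec_subst (F := fun s =>
  iteri (nth 0 s 0) (G (behead s)) (F (behead s)))).
by apply: (RecPrim rF rG).
Qed.

Lemma rec_drop_second n F : rec n.+1 (fun s => F (nth 0 s 0) (behead s)) ->
  rec n.+2 (fun s => F (nth 0 s 0) (behead (behead s))).
Proof.
move=> rF; pose H i s := nth 0 s (if i is j.+1 then j.+2 else 0).
apply: rec_ext (rec_comp (G := H) rF _) => [|i _]; last exact: rec_var.
move=> [|a [|b s]] //= [sn]; congr F.
rewrite (iotaDl 1 0) -map_comp -[RHS](mkseq_nth 0) sn.
exact: eq_map.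
Qed.

Lemma rec_drop_first n F : rec n.+1 (fun s => F (nth 0 s 0) (behead s)) ->
  rec n.+2 (fun s => F (nth 0 s 1) (behead (behead s))).
Proof.
move=> rF; pose H i s := nth 0 s i.+1.
apply: rec_ext (rec_comp (G := H) rF _) => [|i _]; last exact: rec_var.
move=> [|a [|b s]] //= [sn]; congr F.
rewrite (iotaDl 1 0) -map_comp -[RHS](mkseq_nth 0) sn.
exact: eq_map.
Qed.

Lemma rec_iter n F G T : rec n F ->
  rec n.+1 (fun s => G (behead s) (nth 0 s 0)) -> rec n T ->
  rec n (fun s => iter (T s) (G s) (F s)).
Proof.
move=> rF rG rT.
have rG' := rec_drop_first (F := fun x s => G s x) rG.
apply: rec_ext (rec_iteri (G := fun s _ => G s) rF rG' rT) => s _.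
by elim: (T s) => //= k ->.
Qed.

Lemma rec_succ n F : rec n F -> rec n (fun s => (F s).+1).
Proof. by apply: rec_app1; apply: RecSucc => x; rewrite (tuple_eta x). Qed.

Lemma rec_add n F G : rec n F -> rec n G -> rec n (fun s => F s + G s).
Proof.
move=> rF rG; apply: rec_ext (rec_iter (G := fun=> succn) rG _ rF) => [s _|].
  by elim: (F s) => //= k ->.
exact/rec_succ/rec_var.
Qed.

Lemma rec_bsum n T F :
  rec n T -> rec n.+1 (fun s => F (nth 0 s 0) (behead s)) ->
  rec n (fun s => bsum (T s) (fun i => F i s)).
Proof.
move=> rT rF.
apply: rec_ext (rec_iteri (G := fun s i a => F i s + a) (rec_const n 0) _ rT).
  move=> s _; elim: (T s) => [|k IHk /=]; first by rewrite /bsum big_ord0.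
  by rewrite IHk /bsum big_ord_recr addnC.
by apply: rec_add; [exact: rec_drop_second | exact: rec_var].
Qed.

Lemma rec_mul n F G : rec n F -> rec n G -> rec n (fun s => F s * G s).
Proof.
apply: (rec_app2 (f := muln)).
apply: rec_ext (rec_bsum (F := fun _ s => nth 0 s 1) (rec_var 2 0)
  (rec_var_behead 3 1 1)) => s _.
by rewrite /bsum big_const_ord iter_addn_0 mulnC.
Qed.

Lemma rec_exp n F G : rec n F -> rec n G -> rec n (fun s => F s ^ G s).
Proof.
apply: (rec_app2 (f := expn)).
apply: rec_ext (rec_iter (G := fun s => muln (nth 0 s 0)) (rec_const 2 1) _
  (rec_var 2 1)) => [s _|].
  by elim: (nth 0 s 1) => //= k ->; rewrite expnS.
by apply: rec_mul; [exact: (rec_var_behead 3 1 0) | exact: rec_var].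
Qed.

Lemma rec_pred n F : rec n F -> rec n (fun s => (F s).-1).
Proof.
apply: (rec_app1 (f := predn)).
apply: rec_ext (rec_iteri (G := fun _ i _ => i) (rec_const 1 0) (rec_var 3 0)
  (rec_var 1 0)) => s _.
by case: (nth 0 s 0).
Qed.

Lemma rec_sub n F G : rec n F -> rec n G -> rec n (fun s => F s - G s).
Proof.
move=> rF rG; apply: rec_ext (rec_iter (G := fun=> predn) rF _ rG) => [s _|].
  by elim: (G s) => [|k /= ->]; rewrite ?subn0 // subnS.
exact/rec_pred/rec_var.
Qed.

Lemma rec_neg n (b : seq nat -> bool) :
  rec n (fun s => b s) -> rec n (fun s => ~~ b s).
Proof.
move=> rb; apply: rec_ext (rec_sub (rec_const n 1) rb) => s _.
by case: (b s).
Qed.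

Lemma rec_and n (b c : seq nat -> bool) :
  rec n (fun s => b s) -> rec n (fun s => c s) -> rec n (fun s => b s && c s).
Proof.
by move=> rb rc; apply: rec_ext (rec_mul rb rc) => s _; rewrite mulnb.
Qed.

Lemma rec_or n (b c : seq nat -> bool) :
  rec n (fun s => b s) -> rec n (fun s => c s) -> rec n (fun s => b s || c s).
Proof.
move=> rb rc; apply: rec_ext (rec_neg (rec_and (rec_neg rb) (rec_neg rc))).
by move=> s _; rewrite negb_and !negbK.
Qed.

Lemma rec_imply n (b c : seq nat -> bool) :
  rec n (fun s => b s) -> rec n (fun s => c s) -> rec n (fun s => b s ==> c s).
Proof.
by move=> rb rc; apply: rec_ext (rec_or (rec_neg rb) rc) => s _; case: (b s).
Qed.

Lemma rec_leq n F G : rec n F -> rec n G -> rec n (fun s => F s <= G s).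
Proof.
move=> rF rG; apply: rec_ext (rec_sub (rec_const n 1) (rec_sub rF rG)) => s _.
by rewrite /leq; case: (F s - G s).
Qed.

Lemma rec_eqn n F G : rec n F -> rec n G -> rec n (fun s => F s == G s).
Proof.
move=> rF rG; apply: rec_ext (rec_and (rec_leq rF rG) (rec_leq rG rF)) => s _.
by rewrite eqn_leq.
Qed.

Lemma rec_ball n T (b : nat -> seq nat -> bool) : rec n T ->
  rec n.+1 (fun s => b (nth 0 s 0) (behead s)) ->
  rec n (fun s => ball (T s) (fun i => b i s)).
Proof.
move=> rT rb.
apply: rec_ext (rec_eqn (rec_bsum (F := fun i s => ~~ b i s) rT (rec_neg rb))
  (rec_const n 0)) => s _.
congr nat_of_bool; rewrite /bsum sum_nat_eq0.
by apply: eq_forallb => i; rewrite eqb0 negbK.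
Qed.

Lemma rec_half n F : rec n F -> rec n (fun s => (F s)./2).
Proof.
apply: (rec_app1 (f := half)).
(* Uses that half of i + 1 is i minus half of i. *)
apply: rec_ext (rec_iteri (G := fun _ i a => i - a) (rec_const 1 0)
  (rec_sub (rec_var 3 0) (rec_var 3 1)) (rec_var 1 0)) => s _.
elim: (nth 0 s 0) => //= k ->.
by rewrite uphalf_half -{1}(odd_double_half k); lia.
Qed.

Lemma rec_odd n F : rec n F -> rec n (fun s => odd (F s)).
Proof.
apply: (rec_app1 (f := odd)).
apply: rec_ext (rec_iter (G := fun _ a => 1 - a) (rec_const 1 0)
  (rec_sub (rec_const 2 1) (rec_var 2 0)) (rec_var 1 0)) => s _.
by elim: (nth 0 s 0) => //= k ->; case: (odd k).
Qed.

Lemma rec_mu n (b : seq nat -> bool) h : rec n.+1 (fun s => b s) ->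
  (forall s, size s = n -> b (h s :: s)) ->
  (forall s y, size s = n -> b (y :: s) -> h s <= y) -> rec n h.
Proof.
move=> rb bh hmin; apply: (RecMin (rec_neg rb)) => [x|x y].
  by rewrite /= bh ?size_tuple.
rewrite /= eqb0 negbK ltnNge; apply: contra; apply: hmin.
by rewrite size_tuple.
Qed.

(** * Saturated families coded by numbers *)

Definition bit z i : bool := odd (iter i half z).

(* [CodeSeq.code (n :: s)] is [2 ^ n * (CodeSeq.code s).*2.+1], so the head is
   the number of trailing zero bits. *)
Definition code_head c := bsum c (fun i => ball i.+1 (fun j => ~~ bit c j)).
Definition code_behead c := (iter (code_head c) half c)./2.
Definition code_nth c i := code_head (iter i code_behead c).

(** [~~ ball] of a negation is a bounded existential; [.+1] skips the size of [T], stored in front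
    of the table. *)
Definition num_setmul c a b := bsum (code_nth c 0) (fun k =>
  2 ^ k * ~~ ball (code_nth c 0) (fun i => ball (code_nth c 0) (fun j =>
    ~~ [&& bit a i, bit b j & code_nth c (i * code_nth c 0 + j).+1 == k]))).
Definition num_setpow c a m := iter m (num_setmul c a) a.
Definition num_cup c a m := bsum (code_nth c 0) (fun k =>
  2 ^ k * ~~ ball m (fun i =>
    ~~ bit (num_setpow c a (2 ^ code_nth c 0 + i)) k)).

(** Divisibility is a bounded search for the cofactor q; members of [pi] are prime in the intended
    use. *)
Definition pi'_number (pi : nat_pred) m := (0 < m) &&
  ball m.+1 (fun p => (p \in pi) ==> ball m.+1 (fun q => q * p != m)).

Definition num_saturated (pi : nat_pred) F c :=
  [&& ball (code_nth c 0) (fun i => bit F (2 ^ i)),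
      ball (2 ^ code_nth c 0) (fun a => bit F a ==>
        ball (2 ^ code_nth c 0) (fun b => bit F b ==>
          bit F (num_setmul c a b))),
      ball (2 ^ code_nth c 0) (fun a => bit F a ==>
        ball (2 ^ code_nth c 0) (fun b =>
          ball (code_nth c 0) (fun i => bit b i ==> bit a i) ==> bit F b)) &
      ball (2 ^ code_nth c 0) (fun a => bit F a ==>
        ball (2 ^ code_nth c 0).+1 (fun m => pi'_number pi m ==>
          (num_setpow c a (2 ^ code_nth c 0 + m) ==
             num_setpow c a (2 ^ code_nth c 0)) ==>
          bit F (num_cup c a m)))].

Ltac rec_step := first
  [ exact (rec_var_behead _ 0 _) | exact (rec_var_behead _ 1 _)
  | exact (rec_var_behead _ 2 _) | exact (rec_var_behead _ 3 _)
  | exact (rec_var_behead _ 4 _)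
  | exact (rec_const _ _) | apply: rec_ball | apply: rec_bsum
  | apply: rec_succ | apply: rec_add | apply: rec_mul
  | apply: rec_exp | apply: rec_sub | apply: rec_half | apply: rec_odd
  | apply: rec_neg | apply: rec_and | apply: rec_imply | apply: rec_leq
  | apply: rec_eqn ].

Lemma rec_bit n F G : rec n F -> rec n G -> rec n (fun s => bit (F s) (G s)).
Proof.
by move=> rF rG; apply/rec_odd/(rec_iter (G := fun=> half)) => //;
  repeat rec_step.
Qed.

Lemma rec_code_head n F : rec n F -> rec n (fun s => code_head (F s)).
Proof.
apply: rec_app1; rewrite /code_head.
by repeat first [apply: rec_bit | rec_step].
Qed.

Lemma rec_code_nth n F G :
  rec n F -> rec n G -> rec n (fun s => code_nth (F s) (G s)).
Proof.
move=> rF rG; apply/rec_code_head/(rec_iter (G := fun=> code_behead)) => //.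
apply/rec_half/(rec_iter (G := fun=> half)).
- by repeat rec_step.
- by repeat rec_step.
- by apply: rec_code_head; repeat rec_step.
Qed.

Ltac rec_step_code := first [apply: rec_code_nth | apply: rec_bit | rec_step].

Lemma rec_num_setmul n C F G : rec n C -> rec n F -> rec n G ->
  rec n (fun s => num_setmul (C s) (F s) (G s)).
Proof.
by apply: (rec_app3 (f := num_setmul)); rewrite /num_setmul;
  repeat rec_step_code.
Qed.

Lemma rec_num_setpow n C F G : rec n C -> rec n F -> rec n G ->
  rec n (fun s => num_setpow (C s) (F s) (G s)).
Proof.
apply: (rec_app3 (f := num_setpow)).
apply: (rec_iter (G := fun s a => num_setmul (nth 0 s 0) (nth 0 s 1) a)).
- by repeat rec_step.
- by apply: rec_num_setmul; repeat rec_step.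
- by repeat rec_step.
Qed.

Lemma rec_num_cup n C F G : rec n C -> rec n F -> rec n G ->
  rec n (fun s => num_cup (C s) (F s) (G s)).
Proof.
apply: rec_app3; rewrite /num_cup.
by repeat first [apply: rec_num_setpow | rec_step_code].
Qed.

Lemma rec_mem (pi : nat_pred) n F : recursive_set pi -> rec n F ->
  rec n (fun s => F s \in pi).
Proof.
move=> rpi; apply: (rec_app1 (f := fun x => x \in pi)).
apply: (RecComp rpi (g := fun _ x => nth 0 x 0)) => [_|x]; last first.
  by rewrite /thead tnth_mktuple.
exact: rec_var.
Qed.

Lemma rec_pi'_number (pi : nat_pred) n F : recursive_set pi -> rec n F ->
  rec n (fun s => pi'_number pi (F s)).
Proof.
move=> rpi; apply: (rec_app1 (f := pi'_number pi)); rewrite /pi'_number.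
by repeat first [apply: (rec_mem rpi) | rec_step].
Qed.

Lemma rec_num_saturated (pi : nat_pred) : recursive_set pi ->
  rec 2 (fun s => num_saturated pi (nth 0 s 0) (nth 0 s 1)).
Proof.
move=> rpi; rewrite /num_saturated.
by repeat first [apply: (rec_pi'_number rpi) | apply: rec_num_setmul
  | apply: rec_num_setpow | apply: rec_num_cup | rec_step_code].
Qed.

(** * Decoding tables and binary expansions *)

Lemma bit0 i : bit 0 i = false.
Proof.
by rewrite /bit; suff -> : iter i half 0 = 0 by []; elim: i => //= i ->.
Qed.

Lemma bitS z i : bit z i.+1 = bit z./2 i.
Proof. by rewrite /bit iterSr. Qed.

Lemma bit_double z i : bit z.*2 i.+1 = bit z i.
Proof. by rewrite bitS doubleK. Qed.

Lemma bit_pow2M n z i : bit (2 ^ n * z.*2.+1) i =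
  if i < n then false else bit z.*2.+1 (i - n).
Proof.
elim: n i => [|n IHn] [|i]; rewrite ?mul1n ?subn0 //.
  by rewrite expnS -mulnA mul2n /bit /= odd_double.
by rewrite expnS -mulnA mul2n bit_double IHn.
Qed.

Lemma iter_half_pow2M n z : iter n half (2 ^ n * z) = z.
Proof.
by elim: n => [|n IHn]; rewrite ?mul1n // expnS -mulnA mul2n iterSr doubleK.
Qed.

Lemma code_headE n z : code_head (2 ^ n * z.*2.+1) = n.
Proof.
rewrite /code_head; set c := 2 ^ n * _.
(* The sum in [code_head] stops at c, which must not cut off the n zero bits. *)
have ltnc : n < c.
  by apply: leq_trans (ltn_expl n (ltnSn 1)) _; rewrite leq_pmulr.
transitivity (\sum_(i < c | i < n) 1); last first.
  by rewrite -(big_ord_widen c (fun=> 1)) ?sum1_card ?card_ord // ltnW.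
rewrite [RHS]big_mkcond; apply: eq_bigr => i _.
suff -> : ball i.+1 (fun j => ~~ bit c j) = (i < n) by case: (i < n).
apply/ballP/idP => [H|ltin j ltji].
  rewrite ltnNge; apply/negP => leni; have := H n leni.
  by rewrite bit_pow2M ltnn subnn /bit /= odd_double.
have ltjn : j < n by lia.
by rewrite bit_pow2M ltjn.
Qed.

Lemma code_nthE s i : i < size s -> code_nth (CodeSeq.code s) i = nth 0 s i.
Proof.
elim: s i => // n s IHs [|i] /= => [_|]; first exact: code_headE.
rewrite /code_nth ltnS iterSr => /IHs <-; congr (code_head (iter i _ _)).
by rewrite /code_behead code_headE iter_half_pow2M /= uphalf_double.
Qed.

Lemma nth_allpairs (A B : Type) (f : A -> B -> nat) (s : seq A) (t : seq B)
    x y i j : i < size s -> j < size t ->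
  nth 0 [seq f x y | x <- s, y <- t] (i * size t + j) =
    f (nth x s i) (nth y t j).
Proof.
elim: s i => // a s IHs [|i] /= lei ltj; rewrite nth_cat size_map.
  by rewrite ltj (nth_map y).
by rewrite mulSn -addnA ltnNge leq_addr /= addKn IHs.
Qed.

Lemma table_code_size (T : finSemigroupType) : code_nth (table_code T) 0 = #|T|.
Proof. by rewrite code_nthE. Qed.

Lemma table_code_entry (T : finSemigroupType) (x y : T) :
  code_nth (table_code T) (enum_rank x * #|T| + enum_rank y).+1 =
    enum_rank (x * y)%g.
Proof.
have xT : enum_rank x < size (enum T) by rewrite -cardE.
have yT : enum_rank y < size (enum T) by rewrite -cardE.
pose f (x y : T) := enum_rank (x * y)%g : nat.
rewrite code_nthE /=.
  have := nth_allpairs f x y xT yT.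
  by rewrite !nth_enum_rank -cardE => ->.
rewrite ltnS size_allpairs -cardE.
apply: leq_trans (_ : (enum_rank x).+1 * #|T| <= _).
  by rewrite mulSn addnC ltn_add2r ltn_ord.
by rewrite leq_mul2r ltn_ord orbT.
Qed.

Lemma bit_sum N (b : nat -> bool) j :
  bit (\sum_(i < N) 2 ^ i * b i) j = (j < N) && b j.
Proof.
elim: N b j => [|N IHN] b j; first by rewrite big_ord0 bit0.
rewrite big_ord_recl mul1n.
have -> : \sum_(i < N) 2 ^ lift ord0 i * b (lift ord0 i) =
    (\sum_(i < N) 2 ^ i * b i.+1).*2.
  rewrite -mul2n big_distrr; apply: eq_bigr => i _ /=.
  by rewrite /bump /= add1n expnS mulnA.
case: j => [|j]; first by rewrite /bit /= oddD odd_double addbF oddb.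
by rewrite bitS half_bit_double (IHN (fun i => b i.+1)).
Qed.

Lemma sum_lt N (b : nat -> bool) : \sum_(i < N) 2 ^ i * b i < 2 ^ N.
Proof.
elim: N => [|N IHN]; first by rewrite big_ord0.
rewrite big_ord_recr /= expnS mul2n -addnn -addSn leq_add //.
by case: (b N); rewrite ?muln1 ?muln0.
Qed.

Section BinaryCode.
Variables (V : finType) (N : nat) (c : V -> 'I_N).
Hypothesis c_bij : bijective c.

(** Used twice: with [enum_rank] it is [subset_code], and with [set_code_ord] of that it is
    [family_code]. *)
Definition set_code (A : {set V}) : nat := \sum_(x in A) 2 ^ c x.

Lemma bsum_set_code (A : {set V}) (b : nat -> bool) :
  (forall x, b (c x) = (x \in A)) -> bsum N (fun i => 2 ^ i * b i) = set_code A.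
Proof.
move=> bA; rewrite /bsum (reindex c) /=; last exact: onW_bij.
rewrite /set_code [RHS]big_mkcond; apply: eq_bigr => x _.
by rewrite bA; case: ifP; rewrite ?muln1 ?muln0.
Qed.

Lemma ball_set_code (b : nat -> bool) : ball N b = [forall x, b (c x)].
Proof.
have [g cK gK] := c_bij; apply/forallP/forallP => [H x|H i]; first exact: H.
by rewrite -[i]gK.
Qed.

Lemma set_code_bsum (A : {set V}) : exists2 b : nat -> bool,
  set_code A = \sum_(i < N) 2 ^ i * b i & forall x, b (c x) = (x \in A).
Proof.
pose b i := [exists x in A, c x == i :> nat].
have bA x : b (c x) = (x \in A).
  apply/exists_inP/idP => [[y Ay /eqP/val_inj/(bij_inj c_bij) <-] //|Ax].
  by exists x.
by exists b; rewrite // -(bsum_set_code bA).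
Qed.

Lemma bit_set_code (A : {set V}) x : bit (set_code A) (c x) = (x \in A).
Proof. by have [b -> bA] := set_code_bsum A; rewrite bit_sum ltn_ord bA. Qed.

Lemma set_code_lt (A : {set V}) : set_code A < 2 ^ N.
Proof. by have [b -> _] := set_code_bsum A; apply: sum_lt. Qed.

Definition set_code_ord (A : {set V}) : 'I_(2 ^ N) := Ordinal (set_code_lt A).

Lemma set_code_inj : injective set_code.
Proof. by move=> A B AB; apply/setP => x; rewrite -!bit_set_code AB. Qed.

Lemma set_code_bij : bijective set_code_ord.
Proof.
apply: inj_card_bij => [A B [/set_code_inj //]|].
rewrite card_ord -cardsT -powersetT card_powerset cardsT (bij_eq_card c_bij).
by rewrite card_ord.
Qed.

(** Hence the least code of a saturated family is that of the least saturated family. *)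
Lemma set_code_leq (A B : {set V}) : A \subset B -> set_code A <= set_code B.
Proof.
move=> /setIidPr AB; rewrite /set_code [leqRHS](big_setID A) AB.
exact: leq_addr.
Qed.

End BinaryCode.

(** * Agreement of numeric and set-theoretic saturation *)

Section NumericSaturation.
Variables (pi : nat_pred) (T : finSemigroupType).
Hypothesis pi_prime : forall p, p \in pi -> prime p.
Let c := table_code T.
Let rT := @enum_rank_bij T.
Let rP := set_code_bij rT.

Lemma num_setmulE (A B : {set T}) :
  num_setmul c (subset_code A) (subset_code B) = subset_code (setmul A B).
Proof.
rewrite /num_setmul table_code_size; apply: (bsum_set_code rT) => x.
rewrite (ball_set_code rT) negb_forall; apply/existsP/setmulP.
  move=> [a]; rewrite (ball_set_code rT) negb_forall => /existsP[b].
  rewrite negbK !(bit_set_code rT) table_code_entry.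
  by move=> /and3P[Aa Bb /eqP/val_inj/enum_rank_inj abx]; exists a, b.
move=> [a [b [Aa Bb ->]]]; exists a; rewrite (ball_set_code rT) negb_forall.
apply/existsP; exists b.
by rewrite negbK !(bit_set_code rT) table_code_entry Aa Bb eqxx.
Qed.

Lemma num_setpowE (A : {set T}) m :
  num_setpow c (subset_code A) m = subset_code (setpow A m).
Proof.
elim: m => // m IHm; rewrite /num_setpow iterS -/(num_setpow _ _ _) IHm.
exact: num_setmulE.
Qed.

Lemma num_cupE (A : {set T}) m :
  num_cup c (subset_code A) m =
    subset_code (\bigcup_(i < m) setpow A (2 ^ #|T| + i)).
Proof.
rewrite /num_cup table_code_size; apply: (bsum_set_code rT) => x.
rewrite negb_forall; apply/existsP/bigcupP => [[i]|[i _ Ax]].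
  by rewrite negbK num_setpowE (bit_set_code rT); exists i.
by exists i; rewrite negbK num_setpowE (bit_set_code rT).
Qed.

Lemma pi'_numberE m : pi'_number pi m = pi^'.-nat m.
Proof.
rewrite /pi'_number /pnat; case: posnP => //= m_gt0.
apply/ballP/allP => [H p|H p _].
  rewrite mem_primes => /and3P[p_pr _ /dvdnP[q mE]]; apply/negP => pip.
  have q_gt0 : 0 < q by move: m_gt0; rewrite mE muln_gt0 => /andP[].
  have lepm : p < m.+1 by rewrite ltnS mE leq_pmull.
  have := H p lepm; rewrite pip /= => /ballP/(_ q)/=.
  by rewrite mE eqxx ltnS leq_pmulr ?prime_gt0 // => /(_ erefl).
apply/implyP => pip; apply/ballP => q _; apply/eqP => mE.
have := H p; rewrite mem_primes pi_prime // m_gt0 -mE dvdn_mull //=.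
by move=> /(_ erefl); rewrite inE pip.
Qed.

Lemma num_saturatedE (P : {set {set T}}) :
  num_saturated pi (family_code P) c = saturated pi P.
Proof.
rewrite /num_saturated table_code_size /saturated.
have bitP (A : {set T}) : bit (family_code P) (subset_code A) = (A \in P).
  exact: bit_set_code rP P A.
congr [&& _, _, _ & _].
- rewrite (ball_set_code rT); apply: eq_forallb => x.
  by rewrite -bitP /subset_code big_set1.
- rewrite (ball_set_code rP); apply: eq_forallb => A.
  rewrite bitP; congr (_ ==> _).
  rewrite (ball_set_code rP); apply: eq_forallb => B.
  rewrite bitP; congr (_ ==> _).
  by rewrite num_setmulE bitP.
- rewrite (ball_set_code rP); apply: eq_forallb => A.
  rewrite bitP; congr (_ ==> _).
  rewrite (ball_set_code rP); apply: eq_forallb => B.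
  rewrite bitP; congr (_ ==> _).
  rewrite (ball_set_code rT); apply/forallP/subsetP => H x.
    by apply/implyP; have := H x; rewrite !(bit_set_code rT).
  by rewrite !(bit_set_code rT); apply/implyP; apply: H.
rewrite (ball_set_code rP); apply: eq_forallb => A.
  rewrite bitP; congr (_ ==> _).
apply: eq_forallb => m; rewrite pi'_numberE !num_setpowE num_cupE bitP.
by rewrite (inj_eq (set_code_inj rT)).
Qed.

End NumericSaturation.

(* The second disjunct only makes the search terminate on numbers that are not
   codes of multiplication tables. *)
Definition stop_search (pi : nat_pred) F c : bool :=
  num_saturated pi F c || (2 ^ 2 ^ code_nth c 0 <= F).

Lemma ex_stop_search (pi : nat_pred) c : exists F, stop_search pi F c.
Proof. by exists (2 ^ 2 ^ code_nth c 0); rewrite /stop_search leqnn orbT. Qed.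

Definition least_saturated (pi : nat_pred) c : nat :=
  ex_minn (ex_stop_search pi c).

Lemma rec_least_saturated (pi : nat_pred) : recursive_set pi ->
  rec 1 (fun s => least_saturated pi (nth 0 s 0)).
Proof.
move=> rpi.
apply: (rec_mu (b := fun s => stop_search pi (nth 0 s 0) (nth 0 s 1))).
- by apply: rec_or; [exact: rec_num_saturated | repeat rec_step_code].
- by move=> s _; rewrite /least_saturated /=; case: ex_minnP.
- by move=> s F _ /= sF; rewrite /least_saturated; case: ex_minnP => G _; apply.
Qed.

(** The code of [saturation] stops the search. Conversely a result below the bound codes a saturated
    family, which contains [saturation], and one above it exceeds every code. *)
Lemma least_saturatedE (pi : nat_pred) (T : finSemigroupType) :
  (forall p, p \in pi -> prime p) ->
  least_saturated pi (table_code T) = family_code (saturation pi T).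
Proof.
move=> pi_prime; have rP := set_code_bij (@enum_rank_bij T).
rewrite /least_saturated; case: ex_minnP => F stopF minF; apply/eqP.
rewrite eqn_leq minF /=; last first.
  by rewrite /stop_search num_saturatedE ?saturation_saturated.
have [|leF] := ltnP F (2 ^ 2 ^ #|T|); last first.
  exact: leq_trans (ltnW (set_code_lt rP _)) leF.
have [g _ gK] := set_code_bij rP.
move=> ltF; have FE : F = family_code (g (Ordinal ltF)).
  by rewrite -[LHS]/(nat_of_ord (Ordinal ltF)) -[in LHS](gK (Ordinal ltF)).
move: stopF; rewrite /stop_search table_code_size leqNgt ltF orbF FE.
rewrite num_saturatedE //.
by move=> /saturationS; apply: (set_code_leq (set_code_ord (@enum_rank_bij T))).
Qed.

Theorem corollary2p4 (pi : nat_pred)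
    (pi_prime : forall p, p \in pi -> prime p)
    (pi_rec : recursive_set pi) :
  decidable_pointlikes (Gbar pi).
Proof.
exists (fun x => least_saturated pi (nth 0 x 0)).
  exact: rec_least_saturated.
move=> T; exists (saturation pi T) => [Z|]; first exact: saturation_pointlike.
exact: least_saturatedE.
Qed.
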